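(* There exist primitive vectors $h_{2d}\in U\oplus E_8(-1)$ with $h_{2d}^2=2d>0$ such that $\Gamma^+_{h_{2d}}=\widetilde{\mathrm{O}}^+(N)$.
   Context: $U$ is the hyperbolic plane, $E_8(-1)$ the negative definite even unimodular lattice of rank 8; $L(m)$ is $L$ with form multiplied by $m$, and $nL$ is the orthogonal sum of $n$ copies. $L_{\mathrm{K3}}=3U\oplus 2E_8(-1)$. $M=U(2)\oplus E_8(-2)$ is embedded in $L_{\mathrm{K3}}$ by $(x,u)\mapsto(x,0,x,u,u)$, and $N=U\oplus U(2)\oplus E_8(-2)$ by $(y,z,v)\mapsto(z,y,-z,v,-v)$, so that $N=M^\perp$. $M(1/2)=U\oplus E_8(-1)$ and $\mathrm{O}(M)=\mathrm{O}(M(1/2))$. For an even lattice $L$, $D_L=L^\vee/L$ is the discriminant group with its $\mathbb{Q}/2\mathbb{Z}$-valued quadratic form. Via $L_{\mathrm{K3}}$ there is a natural isomorphism $D_M\cong D_N$ identifying $\mathrm{O}(D_M)=\mathrm{O}(D_N)$. Let $\pi_M:\mathrm{O}(M)\to\mathrm{O}(D_M)$, $\pi_N:\mathrm{O}(N)\to\mathrm{O}(D_N)$ be the natural homomorphisms, and $\widetilde{\mathrm{O}}(N)=\ker\pi_N$. $\mathcal{D}_N$ is a fixed one of the two connected components of $\{[x]\in\mathbb{P}(N\otimes\mathbb{C})\mid (x,x)=0,\ (x,\bar x)>0\}$, $\mathrm{O}^+(N)\subset\mathrm{O}(N)$ is the index 2 subgroup preserving $\mathcal{D}_N$, and $\widetilde{\mathrm{O}}^+(N)=\widetilde{\mathrm{O}}(N)\cap\mathrm{O}^+(N)$.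 For $h\in U\oplus E_8(-1)=M(1/2)$ primitive with $h^2>0$ put $\mathrm{O}(M,h)=\{g\in\mathrm{O}(M)\mid g(h)=h\}$, $\Gamma_h=\pi_N^{-1}(\pi_M(\mathrm{O}(M,h)))$, $\Gamma_h^+=\Gamma_h\cap\mathrm{O}^+(N)$. *)

(* Defs.v *)
From HB Require Import structures.
From mathcomp Require Import all_boot all_order all_algebra.
From mathcomp Require Import ring_quotient complex ring.
From mathcomp Require Import all_classical all_reals topology normedtype.

Set Implicit Arguments.
Unset Strict Implicit.
Unset Printing Implicit Defensive.

Import Order.TTheory GRing.Theory Num.Theory.
Import numFieldNormedType.Exports.
Local Open Scope ring_scope.
Local Open Scope classical_set_scope.
Local Open Scope quotient_scope.

(* The lattice is 'rV[int]_rk with the form given by the Gram matrix.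
   Nondegeneracy is not part of the record. *)
Record evenLattice := EvenLattice {
  rk : nat;
  gram : 'M[int]_rk;
  gram_sym : gram^T = gram;
  gram_even : forall i, (2 %| gram i i)%Z
}.

Section Bil.
Variables (K : comNzRingType) (L : evenLattice).

(* The bilinear form, extended to L tensor K. *)
Definition bil (x y : 'rV[K]_(rk L)) : K :=
  (x *m map_mx intr (gram L) *m y^T) 0 0.

Lemma bilE x y :
  bil x y = \sum_i \sum_j x 0 i * (gram L i j)%:~R * y 0 j.
Proof.
rewrite /bil mxE exchange_big; apply: eq_bigr => j _.
rewrite !mxE mulr_suml; apply: eq_bigr => i _.
by rewrite !mxE.
Qed.
Lemma bilC x y : bil x y = bil y x.
Proof.
rewrite !bilE exchange_big; apply: eq_bigr => i _; apply: eq_bigr => j _.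
by rewrite mulrC mulrA -{1}gram_sym mxE mulrAC -mulrA mulrCA mulrA.
Qed.
Lemma bilDl x y z : bil (x + y) z = bil x z + bil y z.
Proof. by rewrite /bil !mulmxDl mxE. Qed.
Lemma bilNl x y : bil (- x) y = - bil x y.
Proof. by rewrite /bil !mulNmx mxE. Qed.
Lemma bilDr x y z : bil x (y + z) = bil x y + bil x z.
Proof. by rewrite bilC bilDl !(bilC x). Qed.
Lemma bilNr x y : bil x (- y) = - bil x y.
Proof. by rewrite bilC bilNl bilC. Qed.
Lemma bil0l y : bil 0 y = 0.
Proof. by rewrite /bil !mul0mx mxE. Qed.
Lemma bil0r x : bil x 0 = 0.
Proof. by rewrite bilC bil0l. Qed.
End Bil.

Lemma bil_intr (K : comNzRingType) L (x y : 'rV[int]_(rk L)) :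
  bil (map_mx intr x) (map_mx intr y) = (bil x y)%:~R :> K.
Proof.
rewrite !bilE rmorph_sum; apply: eq_bigr => i _.
rewrite rmorph_sum; apply: eq_bigr => j _.
by rewrite !mxE !rmorphM /= intz.
Qed.

Lemma scale_sym (m : int) L : (m *: gram L)^T = m *: gram L.
Proof. by rewrite linearZ /= gram_sym. Qed.
Lemma scale_even (m : int) L i : (2 %| (m *: gram L) i i)%Z.
Proof. by rewrite mxE dvdz_mull // gram_even. Qed.
Definition scaleL (m : int) L : evenLattice :=
  EvenLattice (scale_sym m L) (@scale_even m L).

Lemma osum_sym L1 L2 :
  (block_mx (gram L1) 0 0 (gram L2))^T = block_mx (gram L1) 0 0 (gram L2).
Proof. by rewrite tr_block_mx !trmx0 !gram_sym. Qed.
Lemma osum_even L1 L2 i :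
  (2 %| (block_mx (gram L1) 0 0 (gram L2)) i i)%Z.
Proof.
by case: (split_ordP i) => j ->; rewrite ?block_mxEul ?block_mxEdr gram_even.
Qed.
Definition osum L1 L2 : evenLattice :=
  EvenLattice (@osum_sym L1 L2) (@osum_even L1 L2).

Definition U_gram : 'M[int]_2 := \matrix_(i, j) (i != j)%:R.
Lemma U_sym : U_gram^T = U_gram.
Proof. by apply/matrixP=> i j; rewrite !mxE eq_sym. Qed.
Lemma U_even i : (2 %| U_gram i i)%Z.
Proof. by rewrite mxE eqxx. Qed.
Definition U : evenLattice := EvenLattice U_sym U_even.

(* Edges of the E8 Dynkin diagram: the branches at node 3 have lengths
   1 (node 1), 2 (nodes 2, 0) and 4 (nodes 4, 5, 6, 7). *)
Definition E8_edges : seq (nat * nat) :=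
  [:: (0, 2); (2, 3); (1, 3); (3, 4); (4, 5); (5, 6); (6, 7)]%N.
Definition E8n_entry (i j : nat) : int :=
  if i == j then -2 else (((i, j) \in E8_edges) || ((j, i) \in E8_edges))%:R.
(* Minus the Cartan matrix of E8. *)
Definition E8n_gram : 'M[int]_8 := \matrix_(i, j) E8n_entry i j.
Lemma E8n_sym : E8n_gram^T = E8n_gram.
Proof. by apply/matrixP=> i j; rewrite !mxE /E8n_entry eq_sym orbC. Qed.
Lemma E8n_even i : (2 %| E8n_gram i i)%Z.
Proof. by rewrite mxE /E8n_entry eqxx. Qed.
Definition E8n : evenLattice := EvenLattice E8n_sym E8n_even.

Definition M : evenLattice := osum (scaleL 2 U) (scaleL 2 E8n).
Definition Mhalf : evenLattice := osum U E8n.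
Definition N : evenLattice := osum U (osum (scaleL 2 U) (scaleL 2 E8n)).
Definition LK3 : evenLattice := osum (osum U (osum U U)) (osum E8n E8n).

Section Embeddings.
Variable V : zmodType.

(* (x, u) |-> (x, 0, x, u, u) *)
Definition embM (w : 'rV[V]_(rk M)) : 'rV[V]_(rk LK3) :=
  let x : 'rV_2 := @lsubmx V 1 2 8 w in
  let u : 'rV_8 := @rsubmx V 1 2 8 w in
  row_mx (row_mx x (row_mx 0 x)) (row_mx u u).

(* (y, z, v) |-> (z, y, -z, v, -v) *)
Definition embN (w : 'rV[V]_(rk N)) : 'rV[V]_(rk LK3) :=
  let y : 'rV_2 := @lsubmx V 1 2 (2 + 8) w in
  let z : 'rV_2 := @lsubmx V 1 2 8 (rsubmx w) in
  let v : 'rV_8 := @rsubmx V 1 2 8 (rsubmx w) in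
  row_mx (row_mx z (row_mx y (- z))) (row_mx v (- v)).

End Embeddings.

Definition integral n (x : 'rV[rat]_n) : bool := x \is a mxOver Num.int.

Lemma integralP n (x : 'rV[rat]_n) :
  reflect (exists y : 'rV[int]_n, x = map_mx intr y) (integral x).
Proof.
apply: (iffP mxOverP) => [hx|[y ->] i j]; last by rewrite mxE intr_int.
exists (\row_j Num.floor (x 0 j)).
by apply/rowP=> j; rewrite !mxE floorK.
Qed.
Lemma integral0 n : integral (0 : 'rV_n).
Proof. by apply/mxOverP => i j; rewrite mxE rpred0. Qed.
Lemma integralD n (x y : 'rV_n) : integral x -> integral y -> integral (x + y).
Proof.
by move=> /mxOverP hx /mxOverP hy; apply/mxOverP => i j; rewrite mxE rpredD.
Qed.
Lemma integralN n (x : 'rV_n) : integral (- x) = integral x.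
Proof. by apply/mxOverP/mxOverP => hx i j; have := hx i j; rewrite mxE rpredN. Qed.
Lemma integralB n (x y : 'rV_n) : integral x -> integral y -> integral (x - y).
Proof. by move=> hx hy; rewrite integralD ?integralN. Qed.
Lemma integral_congr n (x y : 'rV_n) :
  integral (x - y) -> integral x = integral y.
Proof.
move=> h; apply/idP/idP => hi; last by have := integralD h hi; rewrite subrK.
by have := integralB hi h; rewrite opprB addrC subrK.
Qed.
Lemma integral_row_mx m n (x : 'rV_m) (y : 'rV_n) :
  integral (row_mx x y) = integral x && integral y.
Proof.
apply/mxOverP/andP => [h|[/mxOverP hx /mxOverP hy] i j].
  split; apply/mxOverP => i j.
    by have := h i (lshift n j); rewrite row_mxEl.
  by have := h i (rshift m j); rewrite row_mxEr.
by case: (split_ordP j) => k ->; rewrite ?row_mxEl ?row_mxEr.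
Qed.

Section Discriminant.
Variable L : evenLattice.

Definition in_dual : pred 'rV[rat]_(rk L) :=
  fun x => `[< forall y : 'rV[int]_(rk L),
    bil x (map_mx intr y) \is a Num.int >].

Lemma in_dual_zmod : zmod_closed in_dual.
Proof.
split=> [|x y /asboolP hx /asboolP hy]; apply/asboolP => z.
  by rewrite bil0l rpred0.
by rewrite bilDl bilNl rpredB.
Qed.
HB.instance Definition _ := GRing.isZmodClosed.Build _ in_dual in_dual_zmod.

Record dualL := DualL { dual_val : 'rV[rat]_(rk L); _ : dual_val \in in_dual }.
HB.instance Definition _ := [isSub for dual_val].
HB.instance Definition _ := [Choice of dualL by <:].
HB.instance Definition _ := [SubChoice_isSubZmodule of dualL by <:].

Definition in_lattice (x : dualL) : bool := integral (val x).
Lemma in_lattice_zmod : zmod_closed in_lattice.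
Proof.
split=> [|x y hx hy]; rewrite unfold_in /in_lattice.
  by rewrite raddf0 integral0.
by rewrite raddfB integralB.
Qed.
HB.instance Definition _ :=
  GRing.isZmodClosed.Build _ in_lattice in_lattice_zmod.

Definition disc := Quotient.quot (GRing.ZmodClosed.clone _ in_lattice _).
HB.instance Definition _ := GRing.Zmodule.on disc.
HB.instance Definition _ := EqQuotient.on disc.

Definition cls (x : dualL) : disc := \pi_disc x.

Lemma cls_eq x y : (cls x == cls y) = integral (val x - val y).
Proof. by rewrite /cls -Quotient.idealrBE unfold_in /in_lattice raddfB. Qed.
Lemma clsD : {morph cls : x y / x + y}.
Proof. by move=> x y; rewrite /cls !piE. Qed.
Lemma cls_repr (x : disc) : cls (repr x) = x.
Proof. exact: reprK. Qed.

End Discriminant.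

Definition even_int (a : rat) : bool := a / 2 \is a Num.int.
Lemma even_int_zmod : zmod_closed even_int.
Proof.
split=> [|x y hx hy]; rewrite unfold_in /even_int ?mul0r ?rpred0 //.
by rewrite mulrBl rpredB.
Qed.
HB.instance Definition _ :=
  GRing.isZmodClosed.Build _ even_int even_int_zmod.
Definition QmodZ2 := Quotient.quot (GRing.ZmodClosed.clone _ even_int _).
HB.instance Definition _ := GRing.Zmodule.on QmodZ2.
HB.instance Definition _ := EqQuotient.on QmodZ2.

Lemma bil_even L (x : 'rV[int]_(rk L)) : (2 %| bil x x)%Z.
Proof.
pose F (i j : 'I_(rk L)) : int := x 0 i * gram L i j * x 0 j.
have FC i j : F i j = F j i.
  by rewrite /F -{1}gram_sym mxE mulrC mulrA [RHS]mulrAC mulrAC.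
have -> : bil x x =
    \sum_i F i i + (\sum_(i < rk L) \sum_(j < rk L | (i < j)%N) F i j) *+ 2.
  rewrite bilE mulr2n [X in _ = _ + (_ + X)](exchange_big_dep predT) //=.
  rewrite -!big_split /=.
  apply: eq_bigr => i _; rewrite (bigD1 i) //= (bigID (fun j : 'I_(rk L) => (i < j)%N)) /=.
  congr (_ + (_ + _)); first by rewrite /F intz.
    apply: eq_big => [j|j _]; last by rewrite /F intz.
    by rewrite -val_eqE /=; case: ltngtP.
  apply: eq_big => [j|j _]; last by rewrite FC /F intz.
  by rewrite -val_eqE /=; case: ltngtP.
apply: rpredD; last by rewrite -[_ *+ 2]mulr_natr; apply: dvdz_mull.
by apply: rpred_sum => i _; rewrite /F mulrAC; apply: dvdz_mull; apply: gram_even.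
Qed.

Section DiscQ.
Variable L : evenLattice.

(* x + L |-> (x, x) mod 2Z; see disc_qE. *)
Definition disc_q (x : disc L) : QmodZ2 :=
  \pi_QmodZ2 (bil (val (repr x)) (val (repr x))).

Lemma QmodZ2_eq (a b : rat) :
  (\pi_QmodZ2 a == \pi_QmodZ2 b) = ((a - b) / 2 \is a Num.int).
Proof. by rewrite -Quotient.idealrBE. Qed.

Lemma disc_qE (x : dualL L) : disc_q (cls x) = \pi_QmodZ2 (bil (val x) (val x)).
Proof.
apply/eqP; rewrite QmodZ2_eq; set y := repr _.
have : cls y == cls x by rewrite cls_repr.
rewrite cls_eq => /integralP[l hl].
have -> : val y = val x + map_mx intr l by rewrite -hl addrC subrK.
rewrite bilDl !bilDr (bilC (map_mx _ _)) bil_intr.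
set a := bil _ _; set b := bil _ _.
have -> : a + b + (b + (bil l l)%:~R) - a = b * 2 + (bil l l)%:~R.
  by ring.
rewrite mulrDl mulfK // rpredD //.
  by have /asboolP := valP x; apply.
have /dvdzP[q ->] := bil_even l.
by rewrite rmorphM /= mulfK // intr_int.
Qed.

Record orthD := OrthD {
  orthD_fun :> disc L -> disc L;
  orthD_bij : bijective orthD_fun;
  orthD_add : {morph orthD_fun : x y / x + y};
  orthD_q : forall x, disc_q (orthD_fun x) = disc_q x
}.

Lemma orthD_eq (f g : orthD) : f =1 g -> f = g.
Proof.
case: f g => f f1 f2 f3 [g g1 g2 g3] /= /funext fg; subst g.
by congr OrthD; exact: Prop_irrelevance.
Qed.

Definition orthD1 : orthD :=
  @OrthD id (inv_bij (frefl _)) (fun _ _ => erefl) (frefl _).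

End DiscQ.

(* O(L); matrices act on row vectors from the right. *)
Record orth (L : evenLattice) := Orth {
  orth_mx :> 'M[int]_(rk L);
  orth_unit : orth_mx \in unitmx;
  orth_gram : orth_mx *m gram L *m orth_mx^T = gram L
}.

Section Action.
Variables (L : evenLattice) (g : orth L).

Definition act (K : comNzRingType) (x : 'rV[K]_(rk L)) : 'rV[K]_(rk L) :=
  x *m map_mx intr g.
Definition act_inv (K : comNzRingType) (x : 'rV[K]_(rk L)) : 'rV[K]_(rk L) :=
  x *m map_mx intr (invmx g).

Lemma actK (K : comNzRingType) : cancel (@act K) (@act_inv K).
Proof.
move=> x; rewrite /act /act_inv -mulmxA -map_mxM mulmxV ?orth_unit //.
by rewrite map_mx1 mulmx1.
Qed.
Lemma act_invK (K : comNzRingType) : cancel (@act_inv K) (@act K).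
Proof.
move=> x; rewrite /act /act_inv -mulmxA -map_mxM mulVmx ?orth_unit //.
by rewrite map_mx1 mulmx1.
Qed.

Lemma bil_act (K : comNzRingType) (x y : 'rV[K]_(rk L)) :
  bil (act x) (act y) = bil x y.
Proof.
have := congr1 (map_mx (intr : int -> K)) (orth_gram g).
rewrite !map_mxM -map_trmx => e.
by rewrite /bil /act trmx_mul -[in RHS]e !mulmxA.
Qed.

Lemma act_intr (K : comNzRingType) (x : 'rV[int]_(rk L)) :
  act (map_mx intr x) = map_mx intr (x *m g) :> 'rV[K]_(rk L).
Proof. by rewrite /act map_mxM. Qed.
Lemma act_inv_intr (K : comNzRingType) (x : 'rV[int]_(rk L)) :
  act_inv (map_mx intr x) = map_mx intr (x *m invmx g) :> 'rV[K]_(rk L).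
Proof. by rewrite /act_inv map_mxM. Qed.

Lemma act_dual (x : dualL L) : act (val x) \in @in_dual L.
Proof.
apply/asboolP => y; rewrite -[map_mx _ y]act_invK bil_act act_inv_intr.
by have /asboolP := valP x; apply.
Qed.
Lemma act_inv_dual (x : dualL L) : act_inv (val x) \in @in_dual L.
Proof.
apply/asboolP => y; rewrite -bil_act act_invK act_intr.
by have /asboolP := valP x; apply.
Qed.

Definition dact (x : dualL L) : dualL L := DualL (act_dual x).
Definition dact_inv (x : dualL L) : dualL L := DualL (act_inv_dual x).

(* Computed on representatives; see disc_actE. *)
Definition disc_act (x : disc L) : disc L := cls (dact (repr x)).
Definition disc_act_inv (x : disc L) : disc L := cls (dact_inv (repr x)).

Lemma disc_actE (x : dualL L) : disc_act (cls x) = cls (dact x).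
Proof.
apply/eqP; rewrite cls_eq /= /act -mulmxBl.
have : cls (repr (cls x)) == cls x by rewrite cls_repr.
by rewrite cls_eq => /integralP[l ->]; apply/integralP; eexists; apply: act_intr.
Qed.
Lemma disc_act_invE (x : dualL L) : disc_act_inv (cls x) = cls (dact_inv x).
Proof.
apply/eqP; rewrite cls_eq /= /act_inv -mulmxBl.
have : cls (repr (cls x)) == cls x by rewrite cls_repr.
by rewrite cls_eq => /integralP[l ->]; apply/integralP; eexists; apply: act_inv_intr.
Qed.

Lemma disc_act_bij : bijective disc_act.
Proof.
exists disc_act_inv => x; rewrite -[x]cls_repr.
  by rewrite disc_actE disc_act_invE; congr cls; apply/val_inj/actK.
by rewrite disc_act_invE disc_actE; congr cls; apply/val_inj/act_invK.
Qed.
Lemma disc_act_add : {morph disc_act : x y / x + y}.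
Proof.
move=> x y; rewrite -[x]cls_repr -[y]cls_repr -clsD !disc_actE -clsD.
by congr cls; apply/val_inj; apply: mulmxDl.
Qed.
Lemma disc_act_q x : disc_q (disc_act x) = disc_q x.
Proof. by rewrite -[x]cls_repr disc_actE !disc_qE /= bil_act. Qed.

End Action.

Definition piD L (g : orth L) : orthD L :=
  OrthD (disc_act_bij g) (@disc_act_add L g) (@disc_act_q L g).

Lemma bil_osum (K : comNzRingType) L1 L2
    (x1 y1 : 'rV[K]_(rk L1)) (x2 y2 : 'rV[K]_(rk L2)) :
  @bil K (osum L1 L2) (row_mx x1 x2) (row_mx y1 y2) = bil x1 y1 + bil x2 y2.
Proof.
rewrite /bil /= map_block_mx !map_mx0 mul_row_block !mulmx0 addr0 add0r.
by rewrite tr_row_mx mul_row_col mxE.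
Qed.

Lemma bil_scale (K : comNzRingType) m L (x y : 'rV[K]_(rk L)) :
  @bil K (scaleL m L) x y = m%:~R * bil x y.
Proof.
rewrite !bilE mulr_sumr; apply: eq_bigr => i _.
rewrite mulr_sumr; apply: eq_bigr => j _.
by rewrite mxE intrM; ring.
Qed.

Lemma bil_M (K : comNzRingType) (x y : 'rV[K]_(rk U)) (u v : 'rV[K]_(rk E8n)) :
  @bil K M (row_mx x u) (row_mx y v) = (bil x y + bil u v) * 2.
Proof. by rewrite /M bil_osum !bil_scale; ring. Qed.

Lemma embME (V : zmodType) (x : 'rV[V]_2) (u : 'rV[V]_8) :
  embM (row_mx x u) = row_mx (row_mx x (row_mx 0 x)) (row_mx u u).
Proof. by rewrite /embM !(@row_mxKl V 1 2 8) !(@row_mxKr V 1 2 8). Qed.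
Lemma embNE (V : zmodType) (y z : 'rV[V]_2) (v : 'rV[V]_8) :
  embN (row_mx y (row_mx z v)) = row_mx (row_mx z (row_mx y (- z))) (row_mx v (- v)).
Proof.
rewrite /embN !(@row_mxKl V 1 2 (2 + 8)) !(@row_mxKr V 1 2 (2 + 8)).
by rewrite !(@row_mxKl V 1 2 8) !(@row_mxKr V 1 2 8).
Qed.

Lemma splitM (V : Type) (w : 'rV[V]_(rk M)) :
  exists x : 'rV[V]_2, exists u : 'rV[V]_8, w = row_mx x u.
Proof. by exists (@lsubmx V 1 2 8 w), (@rsubmx V 1 2 8 w); rewrite hsubmxK. Qed.
Lemma splitN (V : Type) (w : 'rV[V]_(rk N)) :
  exists y : 'rV[V]_2, exists z : 'rV[V]_2, exists v : 'rV[V]_8,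
    w = row_mx y (row_mx z v).
Proof.
have [z [v e]] := splitM (@rsubmx V 1 2 (2 + 8) w).
by exists (@lsubmx V 1 2 (2 + 8) w), z, v; rewrite -e hsubmxK.
Qed.

Section EmbeddingForms.
Variable K : comNzRingType.

Lemma bil_embM (w w' : 'rV[K]_(rk M)) :
  @bil K LK3 (embM w) (embM w') = bil w w'.
Proof.
have [x [u ->]] := splitM w; have [x' [u' ->]] := splitM w'.
by rewrite !embME bil_M /LK3 !bil_osum bil0l; ring.
Qed.
Lemma bil_embN (w w' : 'rV[K]_(rk N)) :
  @bil K LK3 (embN w) (embN w') = bil w w'.
Proof.
have [y [z [v ->]]] := splitN w; have [y' [z' [v' ->]]] := splitN w'.
by rewrite !embNE /LK3 /N !bil_osum !bil_scale !bilNl !bilNr; ring.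
Qed.
Lemma bil_embMN (w : 'rV[K]_(rk M)) (w' : 'rV[K]_(rk N)) :
  @bil K LK3 (embM w) (embN w') = 0.
Proof.
have [x [u ->]] := splitM w; have [y [z [v ->]]] := splitN w'.
by rewrite embME embNE /LK3 !bil_osum bil0l !bilNr; ring.
Qed.

Lemma embMD (w w' : 'rV[K]_(rk M)) : embM (w + w') = embM w + embM w'.
Proof.
have [x [u ->]] := splitM w; have [x' [u' ->]] := splitM w'.
have e : row_mx x u + row_mx x' u' = row_mx (x + x') (u + u').
  exact: add_row_mx.
by rewrite [X in embM X]e !embME !add_row_mx addr0.
Qed.
Lemma embND (w w' : 'rV[K]_(rk N)) : embN (w + w') = embN w + embN w'.
Proof.
have [y [z [v ->]]] := splitN w; have [y' [z' [v' ->]]] := splitN w'.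
have e : row_mx y (row_mx z v) + row_mx y' (row_mx z' v') =
         row_mx (y + y') (row_mx (z + z') (v + v')).
  by rewrite !add_row_mx.
by rewrite [X in embN X]e !embNE !add_row_mx !opprD.
Qed.
Lemma embMN (w : 'rV[K]_(rk M)) : embM (- w) = - embM w.
Proof.
have [x [u ->]] := splitM w.
have e : - row_mx x u = row_mx (- x) (- u) by exact: opp_row_mx.
by rewrite [X in embM X]e !embME !opp_row_mx oppr0.
Qed.
Lemma embNN (w : 'rV[K]_(rk N)) : embN (- w) = - embN w.
Proof.
have [y [z [v ->]]] := splitN w.
have e : - row_mx y (row_mx z v) = row_mx (- y) (row_mx (- z) (- v)).
  by rewrite !opp_row_mx.
by rewrite [X in embN X]e !embNE !opp_row_mx.
Qed.
End EmbeddingForms.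

Lemma integral_embM (w : 'rV[rat]_(rk M)) : integral (embM w) = integral w.
Proof.
have [x [u ->]] := splitM w.
by rewrite embME !integral_row_mx integral0 andTb !andbb.
Qed.
Lemma integral_embN (w : 'rV[rat]_(rk N)) : integral (embN w) = integral w.
Proof.
have [y [z [v ->]]] := splitN w.
rewrite embNE !integral_row_mx !integralN.
by case: (integral z) (integral y) (integral v) => [] [] [].
Qed.

Lemma mulmx_delta (K : comNzRingType) n (A : 'rV[K]_n) (j : 'I_n) :
  (A *m (map_mx intr (delta_mx 0 j : 'rV[int]_n))^T) 0 0 = A 0 j.
Proof.
rewrite mxE (bigD1 j) //= big1 ?addr0 => [|k kj]; rewrite !mxE ?eqxx ?mulr1 //.
by rewrite (negbTE kj) andbF mulr0.
Qed.

Lemma unimodular_dual L (H : 'M[int]_(rk L)) (x : 'rV[rat]_(rk L)) :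
  gram L *m H = 1%:M -> x \in @in_dual L -> integral x.
Proof.
move=> GH /asboolP hx.
have /integralP[z hz] : integral (x *m map_mx intr (gram L)).
  apply/mxOverP => i j; rewrite ord1.
  have := hx (delta_mx 0 j); congr (_ \is a Num.int).
  by rewrite /bil mulmx_delta.
apply/integralP; exists (z *m H).
by rewrite map_mxM -hz -mulmxA -map_mxM GH map_mx1 mulmx1.
Qed.

Lemma U_unimodular : gram U *m U_gram = 1%:M.
Proof.
apply/matrixP => i j; rewrite !mxE !big_ord_recl big_ord0 !mxE.
by case: i => [[|[]]] // ?; case: j => [[|[]]].
Qed.

Definition E8n_inv_entry (i j : nat) : int :=
  - (nth 0%N (nth [::] [::
    [:: 4; 5; 7; 10; 8; 6; 4; 2];
    [:: 5; 8; 10; 15; 12; 9; 6; 3];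
    [:: 7; 10; 14; 20; 16; 12; 8; 4];
    [:: 10; 15; 20; 30; 24; 18; 12; 6];
    [:: 8; 12; 16; 24; 20; 15; 10; 5];
    [:: 6; 9; 12; 18; 15; 12; 8; 4];
    [:: 4; 6; 8; 12; 10; 8; 6; 3];
    [:: 2; 3; 4; 6; 5; 4; 3; 2]] i) j)%N%:Z.
Definition E8n_inv : 'M[int]_8 := \matrix_(i, j) E8n_inv_entry i j.

Lemma E8n_unimodular : gram E8n *m E8n_inv = 1%:M.
Proof.
have chk : all (fun i => all (fun j =>
    foldr (fun k s => E8n_entry i k * E8n_inv_entry k j + s) 0 (iota 0 8)
    == (i == j)%:R) (iota 0 8)) (iota 0 8) by vm_compute.
apply/matrixP => i j; rewrite !mxE.
have /allP/(_ (val i)) := chk; rewrite mem_iota ltn_ord => /(_ isT).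
move=> /allP/(_ (val j)); rewrite mem_iota ltn_ord => /(_ isT) /eqP.
rewrite val_eqE => <-.
under eq_bigr do rewrite !mxE.
rewrite -(big_mkord predT (fun k => E8n_entry i k * E8n_inv_entry k j)).
by rewrite unlock.
Qed.

Lemma unimodular_nondeg L (H : 'M[int]_(rk L)) (v : 'rV[int]_(rk L)) :
  gram L *m H = 1%:M -> (forall x, bil x v = 0) -> v = 0.
Proof.
move=> GH hv; have Gv : v *m gram L = 0.
  apply/rowP => j; rewrite [RHS]mxE -(hv (delta_mx 0 j)) bilC /bil.
  have mi m n (B : 'M[int]_(m, n)) : map_mx intr B = B.
    by apply/matrixP => i k; rewrite mxE intz.
  by rewrite mi -(mi _ _ (delta_mx 0 j)) mulmx_delta.
by rewrite -[v]mulmx1 -GH mulmxA Gv mul0mx.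
Qed.

(* N is the orthogonal complement of M in LK3. *)
Lemma perp_M (w : 'rV[int]_(rk LK3)) :
  (forall x : 'rV[int]_(rk M), @bil _ LK3 (embM x) w = 0) <->
  exists y, w = embN y.
Proof.
split=> [h|[y ->] x]; last exact: bil_embMN.
have [a [b [c [s [t e]]]]] : exists a : 'rV_2, exists b : 'rV_2,
    exists c : 'rV_2, exists s : 'rV_8, exists t : 'rV_8,
    w = row_mx (row_mx a (row_mx b c)) (row_mx s t).
  exists (@lsubmx _ 1 2 4 (@lsubmx _ 1 6 16 w)).
  exists (@lsubmx _ 1 2 2 (@rsubmx _ 1 2 4 (@lsubmx _ 1 6 16 w))).
  exists (@rsubmx _ 1 2 2 (@rsubmx _ 1 2 4 (@lsubmx _ 1 6 16 w))).
  exists (@lsubmx _ 1 8 8 (@rsubmx _ 1 6 16 w)).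
  exists (@rsubmx _ 1 8 8 (@rsubmx _ 1 6 16 w)).
  by rewrite !hsubmxK.
have ac : a + c = 0.
  apply: (unimodular_nondeg U_unimodular) => x; rewrite bilDr.
  have := h (row_mx x 0); rewrite e embME /LK3 !bil_osum !bil0l.
  by rewrite !addr0 add0r.
have st : s + t = 0.
  apply: (unimodular_nondeg E8n_unimodular) => u; rewrite bilDr.
  have := h (row_mx 0 u); rewrite e embME /LK3 !bil_osum !bil0l.
  by rewrite !addr0 add0r.
exists (row_mx b (row_mx a s)); rewrite e embNE.
by rewrite (canRL (addKr a) ac) (canRL (addKr s) st) !addr0.
Qed.

Lemma dual_M_double (x : 'rV[rat]_2) (u : 'rV[rat]_8) :
  (row_mx x u : 'rV_(rk M)) \in @in_dual M -> integral (x + x) /\ integral (u + u).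
Proof.
move=> /asboolP hw; apply/andP; rewrite -integral_row_mx.
apply: (@unimodular_dual Mhalf (block_mx U_gram 0 0 E8n_inv)).
  rewrite /= mulmx_block !mulmx0 !mul0mx !addr0 !add0r.
  by rewrite U_unimodular E8n_unimodular -scalar_mx_block.
apply/asboolP => y; have := hw y.
have [x' [u' ->]] := splitM y.
rewrite map_row_mx bil_M bil_osum !bilDl.
congr (_ \is a Num.int); ring.
Qed.

(* Classes x in D_M and y in D_N are glued when x + y lies in the overlattice
   LK3 of M + N; see glueE. *)
Definition glue (x : disc M) (y : disc N) : bool :=
  integral (embM (val (repr x)) + embN (val (repr y))).

Lemma glueE (x : dualL M) (y : dualL N) :
  glue (cls x) (cls y) = integral (embM (val x) + embN (val y)).
Proof.
have : cls (repr (cls x)) == cls x by rewrite cls_repr.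
have : cls (repr (cls y)) == cls y by rewrite cls_repr.
rewrite /glue !cls_eq; move: (repr _) (repr _) => y' x'.
rewrite -integral_embN -integral_embM embND embMD embNN embMN => hy hx.
by apply: integral_congr; rewrite opprD addrACA integralD.
Qed.

Lemma glue_exN (x : disc M) : exists y, glue x y.
Proof.
rewrite -[x]cls_repr; move: (repr x) => {}x.
have hy : (row_mx 0 (val x) : 'rV_(rk N)) \in @in_dual N.
  apply/asboolP => y; rewrite -[y](@hsubmxK _ 1 2 (2 + 8)) map_row_mx.
  rewrite (@bil_osum _ U M) bil0l add0r.
  by have /asboolP := valP x; apply.
exists (cls (DualL hy)); rewrite glueE /=.
have h := valP x; have [w [u e]] := splitM (val x); rewrite e in h.
rewrite [dual_val _]e; have [hw hu] := dual_M_double h.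
by rewrite embME embNE !add_row_mx !subrr !addr0 !integral_row_mx hw hu !integral0.
Qed.

Lemma glue_exM (y : disc N) : exists x, glue x y.
Proof.
rewrite -[y]cls_repr; move: (repr y) => {}y.
have [y0 [z [v e]]] := splitN (val y); have /asboolP hy := valP y.
have hx : (row_mx z v : 'rV_(rk M)) \in @in_dual M.
  apply/asboolP => t; have := hy (row_mx 0 t).
  by rewrite e map_row_mx (@bil_osum _ U M) map_mx0 bil0r add0r.
have hy0 : integral y0.
  apply: (unimodular_dual U_unimodular); apply/asboolP => t.
  have := hy (row_mx t 0).
  by rewrite e map_row_mx (@bil_osum _ U M) map_mx0 bil0r addr0.
exists (cls (DualL hx)); rewrite glueE /=.
rewrite [dual_val y]e; have [hz hv] := dual_M_double hx.
by rewrite embME embNE !add_row_mx !subrr add0r !integral_row_mx hz hv hy0 !integral0.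
Qed.

Lemma glue_injM x x' y : glue x y -> glue x' y -> x = x'.
Proof.
rewrite -[x]cls_repr -[x']cls_repr -[y]cls_repr !glueE => h h'.
apply/eqP; rewrite cls_eq -integral_embM embMD embMN.
by have := integralB h h'; rewrite opprD addrACA subrr addr0.
Qed.
Lemma glue_injN x y y' : glue x y -> glue x y' -> y = y'.
Proof.
rewrite -[x]cls_repr -[y]cls_repr -[y']cls_repr !glueE => h h'.
apply/eqP; rewrite cls_eq -integral_embN embND embNN.
by have := integralB h h'; rewrite opprD addrACA subrr add0r.
Qed.

(* The natural isomorphism D_M -> D_N whose graph is LK3 / (M + N), and its
   inverse. *)
Definition gamma (x : disc M) : disc N := xchoose (glue_exN x).
Definition gamma_inv (y : disc N) : disc M := xchoose (glue_exM y).

Lemma gammaP x : glue x (gamma x). Proof. exact: (xchooseP (glue_exN x)). Qed.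
Lemma gamma_invP y : glue (gamma_inv y) y.
Proof. exact: (@xchooseP _ (fun x => glue x y) (glue_exM y)). Qed.
Lemma gammaK : cancel gamma gamma_inv.
Proof. by move=> x; exact: (glue_injM (gamma_invP (gamma x)) (gammaP x)). Qed.
Lemma gamma_invK : cancel gamma_inv gamma.
Proof. by move=> y; exact: (glue_injN (gammaP (gamma_inv y)) (gamma_invP y)). Qed.

Lemma glueD x x' y y' : glue x y -> glue x' y' -> glue (x + x') (y + y').
Proof.
rewrite -[x]cls_repr -[x']cls_repr -[y]cls_repr -[y']cls_repr -!clsD !glueE.
move=> h h'; have := integralD h h'.
by rewrite addrACA -embMD -embND.
Qed.
Lemma gammaD : {morph gamma : x y / x + y}.
Proof.
move=> x y.
exact: (glue_injN (gammaP (x + y)) (glueD (gammaP x) (gammaP y))).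
Qed.
Lemma gamma_invD : {morph gamma_inv : x y / x + y}.
Proof.
move=> x y.
exact: (glue_injM (gamma_invP (x + y)) (glueD (gamma_invP x) (gamma_invP y))).
Qed.

(* gamma is an anti-isometry, so conjugation by it respects isometries. *)
Lemma gamma_q x : disc_q (gamma x) = - disc_q x.
Proof.
suff key (a : dualL M) (b : dualL N) :
    glue (cls a) (cls b) -> disc_q (cls b) = - disc_q (cls a).
  have := key (repr x) (repr (gamma x)); rewrite !cls_repr.
  by apply; exact: gammaP.
rewrite glueE !disc_qE => /integralP[l hl].
apply/eqP; rewrite -[- _]raddfN QmodZ2_eq opprK -bil_embM -bil_embN.
have cd := bil_embMN (val a) (val b).
have -> (c d : 'rV[rat]_(rk LK3)) : bil d c = 0 ->
    bil c c + bil d d = bil (d + c) (d + c) => //.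
  by move=> {}cd; rewrite !bilDl !bilDr (bilC c) cd; ring.
rewrite hl bil_intr; have /dvdzP[q ->] := @bil_even LK3 l.
by rewrite rmorphM /= mulfK // intr_int.
Qed.
Lemma gamma_inv_q y : disc_q (gamma_inv y) = - disc_q y.
Proof. by rewrite -{2}[y]gamma_invK gamma_q opprK. Qed.

Section Theta.
Variable f : orthD M.

Definition theta_fun (y : disc N) : disc N := gamma (f (gamma_inv y)).
Lemma theta_bij : bijective theta_fun.
Proof.
have gb : bijective gamma := Bijective gammaK gamma_invK.
have gib : bijective gamma_inv := Bijective gamma_invK gammaK.
exact: bij_comp gb (bij_comp (orthD_bij f) gib).
Qed.
Lemma theta_add : {morph theta_fun : x y / x + y}.
Proof. by move=> x y; rewrite /theta_fun gamma_invD orthD_add gammaD. Qed.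
Lemma theta_q y : disc_q (theta_fun y) = disc_q y.
Proof. by rewrite /theta_fun gamma_q orthD_q gamma_inv_q opprK. Qed.

(* The identification O(D_M) = O(D_N). *)
Definition theta : orthD N := OrthD theta_bij theta_add theta_q.

End Theta.

Section Projective.
Variables (R : realType) (n : nat).

Definition Cplx : numClosedFieldType := R[i].

Definition nzvec := set_type [set x : 'rV[Cplx]_n | x != 0].
HB.instance Definition _ := Topological.on nzvec.
HB.instance Definition _ := Choice.on nzvec.

Definition proportional (x y : nzvec) : bool :=
  `[< exists c : Cplx, c != 0 /\ set_val x = c *: set_val y >].

Lemma proportional_equiv : equiv_class_of proportional.
Proof.
split=> [x|x y|y x z].
- by apply/asboolP; exists 1; rewrite oner_eq0 scale1r.
- wlog suff : x y / proportional x y -> proportional y x.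
    by move=> h; apply/idP/idP; apply: h.
  move=> /asboolP[c [c0 e]]; apply/asboolP; exists c^-1.
  by rewrite invr_eq0 c0 e scalerA mulVf // scale1r.
- move=> /asboolP[c [c0 e]] /asboolP[d [d0 f]]; apply/asboolP; exists (c * d).
  by rewrite mulf_neq0 // e f scalerA.
Qed.
Canonical proportional_equivRel := EquivRelPack proportional_equiv.
Canonical proportional_encModRel := defaultEncModRel proportional.

Definition projSpace := quotient_topology {eq_quot proportional}.
HB.instance Definition _ := Topological.on projSpace.
HB.instance Definition _ := Quotient.on projSpace.

Definition line (x : nzvec) : projSpace := \pi_projSpace x.

End Projective.

Section Period.
Variables (R : realType) (L : evenLattice).

Definition conjv (x : 'rV[Cplx R]_(rk L)) : 'rV[Cplx R]_(rk L) :=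
  map_mx Num.conj x.

Definition period_set : set (projSpace R (rk L)) :=
  [set line x | x in [set x : nzvec R (rk L) |
    bil (set_val x) (set_val x) = 0 /\
    0 < bil (set_val x) (conjv (set_val x))]].

Definition is_component (D : set (projSpace R (rk L))) : Prop :=
  exists2 p, period_set p & D = connected_component period_set p.

Lemma act_neq0 (g : orth L) (x : nzvec R (rk L)) : act g (set_val x) != 0.
Proof.
apply/eqP => e; have /eqP[] : set_val x != 0 := set_valP x.
by rewrite -[LHS](actK g) e /act_inv mul0mx.
Qed.

Definition nzact (g : orth L) (x : nzvec R (rk L)) : nzvec R (rk L) :=
  exist _ (act g (set_val x)) (mem_set (act_neq0 g x)).

Definition proj_act (g : orth L) (p : projSpace R (rk L)) : projSpace R (rk L) :=
  line (nzact g (repr p)).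

Lemma line_act g x : proj_act g (line x) = line (nzact g x).
Proof.
apply/eqmodP/asboolP.
have /eqmodP/asboolP[c [c0 e]] : line (repr (line x)) = line x by exact: reprK.
exists c; split => //.
change (act g (set_val (repr (line x))) = c *: act g (set_val x)).
by rewrite e /act scalemxAl.
Qed.

End Period.

Definition tildeO : set (orth N) := [set g | piD g = orthD1 N].

Definition Oplus R (D : set (projSpace R (rk N))) : set (orth N) :=
  [set g | [set proj_act g p | p in D] = D].

(* M and M(1/2) have the same underlying Z-module and isometries, so O(M) acts
   on vectors of M(1/2). *)
Definition stab (h : 'rV[int]_(rk Mhalf)) : set (orth M) :=
  [set g | (h : 'rV[int]_(rk M)) *m orth_mx g = h].

Definition Gamma (h : 'rV[int]_(rk Mhalf)) : set (orth N) :=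
  @piD N @^-1` (theta @` (@piD M @` stab h)).

Definition primitive n (v : 'rV[int]_n) : Prop :=
  forall (k : int) (w : 'rV[int]_n), v = k *: w -> k \is a GRing.unit.

(* Main.v *)
Require Import Defs.
From HB Require Import structures.
From mathcomp Require Import all_boot all_order all_algebra.
From mathcomp Require Import ring lra zify.
From mathcomp Require Import all_classical all_reals topology.

Set Implicit Arguments.
Unset Strict Implicit.
Unset Printing Implicit Defensive.

Import Order.TTheory GRing.Theory Num.Theory.
Local Open Scope ring_scope.
Local Open Scope classical_set_scope.

(** Since [pi_N] sends exactly [tildeO] to the identity, it is enough to find a
    primitive [h] of positive norm whose stabilizer in O(M) acts trivially on
    the discriminant group of [M]; then [Gamma h = tildeO], and intersecting
    with O^+(N) gives the claim.  In fact [h] can be chosen with trivial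
    stabilizer in O(M) = O(U + E8(-1)).  Such an [h] exists in [U + L] for every
    negative definite even lattice [L] ([trivial_stabilizer]).

    Write [e], [f] for the isotropic basis of [U] and look for
    [h = A e + B f + v] with [v] in [L] and [A], [B], [v] of decreasing size:
    [B] large compared with [v], and [A] large compared with [B] and [v].  Let
    [g] be an isometry fixing [h].
    - When [A] is large, [e] is the only isotropic vector whose product with
      [h] is [B] ([isotropic_unique]).  As [g e] is isotropic and has the same
      product with [h], [g e = e].
    - Then [g f = p e + f + u] for some [u] in [L], and [(g f, h) = (f, h)] reads
      [p B + (u, v) = 0] with [2 p = - (u, u)].  When [B] is large compared with
      [v], Cauchy-Schwarz forces [u = 0], so [g f = f].
    - Hence [g] acts on [L], the orthogonal complement of [U], and fixes [v].
      Taking [v] to be the sum of the [K ^ i b_i] over a basis [b_i] of [L], this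
      says that the sum of the [K ^ i (g b_i - b_i)] vanishes.  The vectors
      [g b_i - b_i] are bounded independently of [K], so for large [K] they
      behave as the digits of an expansion of 0 in base [K]
      and all vanish ([small_digits_eq0]).

    For [L = E8(-1)], negative definiteness comes from completing squares along
    the Dynkin diagram ([E8n_sum_squares]). *)

(** * Negative definite lattices *)

Section Forms.
Variable L : evenLattice.

Lemma bil_intE (x y : 'rV[int]_(rk L)) : bil x y = (x *m gram L *m y^T) 0 0.
Proof.
rewrite /bil; congr ((_ *m _ *m _) 0 0).
by apply/matrixP => i j; rewrite mxE intz.
Qed.

Lemma bilZl (a : int) (x y : 'rV[int]_(rk L)) : bil (a *: x) y = a * bil x y.
Proof. by rewrite !bil_intE -!scalemxAl mxE. Qed.

Lemma bilZr (a : int) (x y : 'rV[int]_(rk L)) : bil x (a *: y) = a * bil x y.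
Proof. by rewrite bilC bilZl bilC. Qed.

Lemma bil_delta (i : 'I_(rk L)) :
  bil (delta_mx 0 i : 'rV[int]__) (delta_mx 0 i) = gram L i i.
Proof. by rewrite bil_intE trmx_delta -rowE -colE !mxE. Qed.

Definition isometry (g : 'M[int]_(rk L)) : Prop :=
  forall x y : 'rV[int]_(rk L), bil (x *m g) (y *m g) = bil x y.

Definition neg_definite : Prop :=
  forall x : 'rV[int]_(rk L), x != 0 -> bil x x < 0.

Hypothesis negL : neg_definite.

Lemma neg_definite_le0 (x : 'rV[int]_(rk L)) : bil x x <= 0.
Proof. by have [->|/negL/ltW//] := eqVneq x 0; rewrite bil0l. Qed.

Lemma neg_definite_eq0 (x : 'rV[int]_(rk L)) : -1 < bil x x -> x = 0.
Proof. by move=> hx; apply/eqP; apply: contraTT hx => /negL; lia. Qed.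

(** Uniqueness of the base [K] expansion of 0 with digits in a lattice: the last
    digit is divisible by [K], and a nonzero multiple of [K] has norm at least
    [K ^ 2] in absolute value. *)
Lemma small_digits_eq0 (K : int) n (d : nat -> 'rV[int]_(rk L)) :
  0 < K -> (forall i, (i < n)%N -> - bil (d i) (d i) < K ^+ 2) ->
  \sum_(i < n) K ^+ i *: d i = 0 -> forall i, (i < n)%N -> d i = 0.
Proof.
move=> K0; elim: n d => [//|n IHn] d small.
rewrite big_ord_recl /= expr0 scale1r.
under eq_bigr do rewrite /bump /= add1n exprS -scalerA.
rewrite -scaler_sumr; set t := \sum_(i < n) _ => sum0.
have d0E : d 0%N = K *: (- t).
  by rewrite scalerN; apply/eqP; rewrite -addr_eq0 sum0.
have t0 : t = 0.
  apply/oppr_inj; rewrite oppr0; apply: neg_definite_eq0.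
  have := small 0%N isT; rewrite d0E bilZl bilZr.
  set b := bil _ _ => hb.
  have K20 : 0 < K ^+ 2 by rewrite exprn_gt0.
  by rewrite -(ltr_pM2l K20) mulrN1; move: hb; rewrite mulrA -expr2; lra.
case=> [_|i lt_in]; first by rewrite d0E t0 oppr0 scaler0.
by apply: (IHn (fun j => d j.+1)) => // j; apply: (small j.+1).
Qed.

End Forms.

(** * Rigid vectors in [U + L] *)

Section HyperbolicSum.
Variable L : evenLattice.
Notation H := (osum U L).

(** The vector [p e + q f + u] of [U + L]. *)
Definition hyp (p q : int) (u : 'rV[int]_(rk L)) : 'rV[int]_(rk H) :=
  row_mx (\row_(j < 2) if j == 0 then p else q) u.

Lemma hypP (x : 'rV[int]_(rk H)) : exists p q u, x = hyp p q u.
Proof.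
pose y := @lsubmx _ 1 2 (rk L) x; pose u := @rsubmx _ 1 2 (rk L) x.
exists (y 0 0), (y 0 1), u; rewrite -[LHS](@hsubmxK _ 1 2 (rk L)).
congr row_mx; apply/rowP => j; rewrite !mxE.
by case: j => [[|[|//]] hj] /=; congr (x _ _); apply/val_inj.
Qed.

Lemma hyp_inj p q u p' q' u' :
  hyp p q u = hyp p' q' u' -> [/\ p = p', q = q' & u = u'].
Proof.
move=> /eq_row_mx[/rowP e ->].
by have := e 0; have := e 1; rewrite !mxE /= => -> ->.
Qed.

Lemma bil_U (x y : 'rV[int]_2) : @bil int U x y = x 0 0 * y 0 1 + x 0 1 * y 0 0.
Proof.
rewrite (@bil_intE U) !mxE !big_ord_recl !big_ord0 !mxE.
rewrite !big_ord_recl !big_ord0 !mxE /=.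
have -> : lift 0 (0 : 'I_1) = 1 :> 'I_2 by apply/val_inj.
rewrite ?(mulr0,mulr1,addr0,add0r). ring.
Qed.

Lemma bil_hyp p q u p' q' u' :
  bil (hyp p q u) (hyp p' q' u') = p * q' + q * p' + bil u u'.
Proof. by rewrite bil_osum bil_U !mxE. Qed.

Lemma hypD p q u p' q' u' :
  hyp p q u + hyp p' q' u' = hyp (p + p') (q + q') (u + u').
Proof.
rewrite /hyp add_row_mx; congr row_mx; apply/rowP => j.
by rewrite !mxE; case: ifP.
Qed.

Lemma hypZ a p q u : a *: hyp p q u = hyp (a * p) (a * q) (a *: u).
Proof.
rewrite /hyp scale_row_mx; congr row_mx; apply/rowP => j.
by rewrite !mxE; case: ifP.
Qed.

Lemma hypE p q u : hyp p q u = p *: hyp 1 0 0 + q *: hyp 0 1 0 + hyp 0 0 u.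
Proof. by rewrite !hypZ !hypD !mulr1 !mulr0 !addr0 !add0r !scaler0 !add0r. Qed.

Hypothesis negL : neg_definite L.
Variables (A B : int) (v : 'rV[int]_(rk L)).
Hypothesis B_gt0 : 0 < B.
Hypothesis B_large : - (4 * bil v v) < B ^+ 2.
Hypothesis A_large : 2 * B ^+ 2 < 2 * A * B + bil v v.

Let h := hyp A B v.

(** For [x = p e + q f + u], the inequality [(B u - q v)^2 <= 0] together with
    the two hypotheses reads [q (q S - 2 B ^ 2) <= 0], where
    [S = 2 A B + (v, v) > 2 B ^ 2], and this leaves only [q = 0]. *)
Lemma isotropic_unique (x : 'rV[int]_(rk H)) :
  bil x x = 0 -> bil x h = B -> x = hyp 1 0 0.
Proof.
have [p [q [u ->]]] := hypP x; rewrite !bil_hyp => iso xh.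
have := neg_definite_le0 negL (B *: u + (- q) *: v).
rewrite !(bilDl, bilDr, bilZl, bilZr) (bilC v u).
have uvE : bil u v = B - p * B - q * A by lia.
have uuE : bil u u = - (2 * p * q) by lia.
rewrite uvE uuE.
have S_large := A_large; set S := 2 * A * B + bil v v in S_large; set cs := _ + _.
have -> : cs = q * (q * S - 2 * B ^+ 2) by rewrite /cs /S; ring.
have B2 : 0 < B ^+ 2 by rewrite exprn_gt0.
have [q_lt0|q_gt0|q0] := ltgtP q 0; first by nia.
  by nia.
move=> _; subst q.
have u0 : u = 0 by apply: (neg_definite_eq0 negL); rewrite uuE; lia.
move: uvE; rewrite u0 bil0l => pB; congr hyp.
have B0 : B != 0 by rewrite gt_eqF.
by apply: (mulIf B0); lia.
Qed.

Variable g : 'M[int]_(rk H).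
Hypotheses (isog : isometry g) (gh : h *m g = h).

Lemma fix_e : hyp 1 0 0 *m g = hyp 1 0 0.
Proof.
apply: isotropic_unique; first by rewrite isog bil_hyp bil0l; ring.
by rewrite -[in LHS]gh isog bil_hyp bil0l; ring.
Qed.

(** Cauchy-Schwarz enters as [(B u - 2 v)^2 <= 0], where [u] is the component in
    [L] of the image of [f]: it bounds [- B ^ 2 (u, u)] by [- 4 (v, v)], which is
    less than [B ^ 2]. *)
Lemma fix_f : hyp 0 1 0 *m g = hyp 0 1 0.
Proof.
have [p [q [u xE]]] := hypP (hyp 0 1 0 *m g).
have := isog (hyp 0 1 0) (hyp 0 1 0); have := isog (hyp 0 1 0) h.
have := isog (hyp 0 1 0) (hyp 1 0 0); rewrite fix_e gh xE !bil_hyp !bil0r !bil0l.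
move=> q1 xh iso.
have {}q1 : q = 1 by lia. 
subst q.
have := neg_definite_le0 negL (B *: u + (-2) *: v).
rewrite !(bilDl, bilDr, bilZl, bilZr) (bilC v u) => cs.
have u0 : u = 0.
  apply: (neg_definite_eq0 negL).
  have B20 : 0 < B ^+ 2 by rewrite exprn_gt0.
  rewrite -(ltr_pM2l B20).
  move: xh iso cs B_large; set uu := bil u u; set vv := bil v v; set uv := bil u v.
  move=> xh iso cs BL.
  have uvE : uv = - (p * B) by lia.
  have uuE : uu = - (2 * p) by lia.
  rewrite uuE; rewrite uuE uvE in cs.
  nra.
rewrite u0 bil0l in iso; rewrite u0; congr hyp; lia.
Qed.

(** Having fixed [e] and [f], the isometry preserves their orthogonal complement
    [L], where it acts by its lower right block. *)
Lemma fix_perp (u : 'rV[int]_(rk L)) :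
  hyp 0 0 u *m g = hyp 0 0 (u *m @drsubmx _ 2 (rk L) 2 (rk L) g).
Proof.
have [p [q [w xE]]] := hypP (hyp 0 0 u *m g).
have := isog (hyp 0 0 u) (hyp 1 0 0); have := isog (hyp 0 0 u) (hyp 0 1 0).
rewrite fix_e fix_f xE !bil_hyp !bil0r => p0 q0.
have -> : p = 0 by lia.
have -> : q = 0 by lia.
congr hyp; have := congr1 (@rsubmx _ 1 2 (rk L)) xE.
rewrite /hyp row_mxKr => <-.
rewrite -[in LHS](@submxK _ 2 (rk L) 2 (rk L) g) mul_row_block row_mxKr.
rewrite (_ : \row_j _ = 0) ?mul0mx ?add0r //.
by apply/rowP => j; rewrite !mxE; case: ifP.
Qed.

Variable K : int.
Hypotheses (K_gt0 : 0 < K) (vE : v = \row_i K ^+ i).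
Hypothesis K_large : forall i, - (4 * gram L i i) < K ^+ 2.

(** If [w] is the image of a basis vector [b], then
    [(w - b)^2 = 4 (b, b) - (w + b)^2 >= 4 (b, b)], so that [w - b] is a digit in
    the sense of [small_digits_eq0]. *)
Lemma stab_trivial : g = 1%:M.
Proof.
have perpE := fix_perp.
set W := @drsubmx _ 2 (rk L) 2 (rk L) g in perpE.
have isoW (u : 'rV[int]_(rk L)) : bil (u *m W) (u *m W) = bil u u.
  have := isog (hyp 0 0 u) (hyp 0 0 u).
  by rewrite !perpE !bil_hyp !mul0r !add0r.
have vW : v *m W = v.
  have := gh; rewrite {1}/h hypE !mulmxDl -!scalemxAl fix_e fix_f perpE -hypE.
  by case/hyp_inj.
pose d (i : 'I_(rk L)) : 'rV[int]_(rk L) := delta_mx 0 i *m W - delta_mx 0 i.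
(* The digits as a sequence on [nat], with 0 from index [rk L] on. *)
pose d' i : 'rV[int]_(rk L) := if insub i is Some j then d j else 0.
have d'E (i : 'I_(rk L)) : d' i = d i by rewrite /d' valK.
have d0 i : d i = 0.
  rewrite -d'E; apply: (small_digits_eq0 negL K_gt0 (n := rk L)) => //.
    move=> j hj; have -> : j = Ordinal hj by [].
    rewrite d'E /d; set b := delta_mx _ _; set w := b *m W.
    apply: le_lt_trans (K_large (Ordinal hj)).
    have := neg_definite_le0 negL (w + b).
    have := isoW b; rewrite -/w !(bilDl, bilDr, bilNl, bilNr) (bilC w b).
    by rewrite -(bil_delta (Ordinal hj)) -/b; lia.
  have := vW; rewrite vE {1 2}(row_sum_delta (\row_i _)) mulmx_suml.
  move/eqP; rewrite -subr_eq0 -sumrB => /eqP sum0; rewrite -[RHS]sum0.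
  by apply: eq_bigr => j _; rewrite d'E mxE -scalemxAl -scalerBr.
have W1 : W = 1%:M.
  by apply/row_matrixP => i; rewrite row1 rowE; apply/eqP;
     rewrite -subr_eq0 [_ - _]d0.
apply/row_matrixP => i; rewrite !rowE mulmx1.
have [p [q [u ->]]] := hypP (delta_mx 0 i).
by rewrite hypE !mulmxDl -!scalemxAl fix_e fix_f perpE W1 mulmx1.
Qed.

End HyperbolicSum.

Lemma trivial_stabilizer L : neg_definite L ->
  exists h : 'rV[int]_(rk (osum U L)),
    [/\ primitive h, 0 < bil h h &
        forall g, @isometry (osum U L) g -> h *m g = h -> g = 1%:M].
Proof.
move=> negL.
pose s : int := \sum_(i < rk L) - gram L i i.
have gram_le0 i : 0 <= - gram L i i.
  by rewrite oppr_ge0 -bil_delta neg_definite_le0.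
have gram_le i : - gram L i i <= s.
  by rewrite /s (bigD1 i) //= lerDl sumr_ge0.
have s_ge0 : 0 <= s by apply: sumr_ge0.
pose v : 'rV[int]_(rk L) := \row_i (2 * s + 1) ^+ i.
have := neg_definite_le0 negL v; set q := bil v v => q_le0.
(* [2 A - 3 B = 1] for every [q], which makes the vector primitive. *)
pose B : int := 1 - 2 * q; pose A : int := 2 - 3 * q.
have B0 : 0 < B by rewrite /B; lia.
have BL : - (4 * q) < B ^+ 2 by rewrite /B; nia.
have AL : 2 * B ^+ 2 < 2 * A * B + q by rewrite /A /B; nia.
exists (hyp A B v); split.
- move=> k w; have [a [b [u ->]]] := hypP w; rewrite hypZ => /hyp_inj[Aa Bb _].
  apply/unitrPr; exists (2 * a - 3 * b).
  have -> : k * (2 * a - 3 * b) = 2 * (k * a) - 3 * (k * b) by ring.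
  by rewrite -Aa -Bb /A /B; ring.
- by rewrite bil_hyp -/q; nia.
- move=> g isog gh; apply: (stab_trivial negL B0 BL AL isog gh (K := 2 * s + 1)) => //.
    by lia.
  by move=> i; have := gram_le0 i; have := gram_le i; nia.
Qed.

(** * Negative definiteness of E8(-1) *)

(** The variables are eliminated from the three ends of the Dynkin diagram
    towards the branch node 3, where the coefficient
    [2 - 2/3 - 1/2 - 4/5 = 1/30] remains; 60 clears the denominators. *)
Lemma E8n_sum_squares (f : nat -> int) :
  60 * (\sum_(i < 8) \sum_(j < 8) f i * E8n_entry i j * f j) =
  - (30 * (2 * f 0%N - f 2%N) ^+ 2
   + 10 * (3 * f 2%N - 2 * f 3%N) ^+ 2 + 30 * (2 * f 1%N - f 3%N) ^+ 2
   + 30 * (2 * f 7%N - f 6%N) ^+ 2 + 10 * (3 * f 6%N - 2 * f 5%N) ^+ 2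
   + 5 * (4 * f 5%N - 3 * f 4%N) ^+ 2 + 3 * (5 * f 4%N - 4 * f 3%N) ^+ 2
   + 2 * f 3%N ^+ 2).
Proof.
rewrite !big_ord_recl !big_ord0 /= /bump /= !add1n.
rewrite /E8n_entry /= ?(mulr0, mul0r, add0r, addr0, mulr1).
ring.
Qed.

Lemma E8n_neg_definite : neg_definite E8n.
Proof.
move=> x; apply: contra_neqT; rewrite -leNgt => bx.
pose f i := x 0 (inord i : 'I_8).
have := E8n_sum_squares f.
have <- : bil x x = \sum_(i < 8) \sum_(j < 8) f i * E8n_entry i j * f j.
  rewrite bilE; apply: eq_bigr => i _; apply: eq_bigr => j _.
  by rewrite /f !inord_val !mxE intz.
move=> bE; have : - (60 * bil x x) <= 0 by rewrite oppr_le0 mulr_ge0.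
have sq_ge0 (c : nat) (y : int) : 0 <= c%:R * y ^+ 2.
  by rewrite mulr_ge0 ?ler0n ?sqr_ge0.
have sq_eq0 (c : nat) (y : int) : (c.+1%:R * y ^+ 2 == 0) = (y == 0).
  by rewrite mulf_eq0 pnatr_eq0 sqrf_eq0.
rewrite {}bE opprK le_eqVlt ltNge !addr_ge0 ?sq_ge0 // orbF.
rewrite !paddr_eq0 ?addr_ge0 ?sq_ge0 // !sq_eq0.
do 7!case/andP => + /eqP ?; move/eqP => ?.
apply/rowP => i; rewrite mxE -[i]inord_val -/(f i).
by case: i => [[|[|[|[|[|[|[|[|//]]]]]]]] hi] /=; lia.
Qed.

(** * From trivial stabilizers to the groups Gamma *)

(** The form of [M] is twice that of [Mhalf], hence the same isometries. *)
Lemma orth_M_isometry (g : orth M) : @isometry Mhalf g.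
Proof.
have bil2 (x y : 'rV[int]_10) : @bil int M x y = 2 * @bil int Mhalf x y.
  have [x1 [x2 ->]] := splitM x; have [y1 [y2 ->]] := splitM y.
  by rewrite bil_M bil_osum mulrC.
have act_intE (x : 'rV[int]_10) : act g x = x *m g.
  by congr mulmx; apply/matrixP => i j; rewrite mxE intz.
by move=> x y; apply: (@mulfI int 2) => //; rewrite -!bil2 -!act_intE bil_act.
Qed.

Lemma piD_eq1 L (g : orth L) : orth_mx g = 1%:M -> piD g = orthD1 L.
Proof.
move=> g1; apply: orthD_eq => x; rewrite /= -[x]cls_repr disc_actE.
by congr cls; apply/val_inj; rewrite /= /act g1 map_mx1 mulmx1.
Qed.

Lemma theta1 : theta (orthD1 M) = orthD1 N.
Proof. by apply: orthD_eq => y; apply: gamma_invK. Qed.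

Lemma orth1_gram L : 1%:M *m gram L *m 1%:M^T = gram L.
Proof. by rewrite trmx1 mul1mx mulmx1. Qed.

Definition orth1 L : orth L := Orth (unitmx1 _ _) (orth1_gram L).

Lemma Gamma_trivial_stab h :
  (forall g, stab h g -> orth_mx g = 1%:M) -> Gamma h = tildeO.
Proof.
move=> h1; apply/seteqP; split=> [g [_ [k /h1 k1 <-] gE]|g gE].
  by rewrite /tildeO /= -gE piD_eq1 // theta1.
exists (orthD1 M); last by rewrite theta1.
by exists (orth1 M); [rewrite /stab /= mulmx1|apply: piD_eq1].
Qed.

Theorem proposition5p7 (R : realType) (D : set (projSpace R (rk N)))
    (hD : is_component D) :
  exists (d : int) (h : 'rV[int]_(rk Mhalf)),
    [/\ primitive h, bil h h = 2 * d, 0 < 2 * d &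
        Gamma h `&` Oplus D = tildeO `&` Oplus D].
Proof.
have [h [h_prim h_gt0 h_rigid]] := trivial_stabilizer E8n_neg_definite.
have /dvdzP[d hd] := @bil_even Mhalf h.
have {}hd : bil h h = 2 * d by rewrite mulrC.
exists d, h; split=> //; first by rewrite -hd.
rewrite Gamma_trivial_stab // => g gh.
by apply: h_rigid => //; apply: orth_M_isometry.
Qed.
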